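(* Unweighted SSSD enumeration can be solved (without preprocessing) with delay in $O(\Delta)$, using $\Theta(n)$ lazy-initialized memory and with space complexity in $\Theta(n)$.
   Context: Input: a directed or undirected, unweighted graph $G=(V,E)$ with $V=\{1,\dots,n\}$, $|E|=m$, and a source vertex $s\in V$. The degree $\deg(v)$ of a vertex is its number of outgoing edges; $\Delta$ is the maximum degree. $d(s,t)$ is the minimum number of (directed) edges on a path from $s$ to $t$, with $d(s,t)=\infty$ if $t$ is unreachable and $d(s,s)=0$. SSSD enumeration: output, for each $t\in V$, the pair $(t,d(s,t))$ exactly once, one by one, without repetition. An algorithm has delay in $O(f)$ if the time until the first output, the time between any two consecutive outputs, and the time after the last output until it detects and signals that no further output exists, are each in $O(f)$; preprocessing time is additional time allowed before the first delay starts (here none beyond constant). Model: word RAM with word size $\Omega(\log n)$; the graph is given as read-only adjacency lists with constant-time access to $n$ and to the degree of each vertex. Lazy-initialized memory is memory that can be allocated in constant time without initialization, where reads of unwritten cells can be detected in constant time (implemented via an auxiliary array of pointer/value pairs and a counter). *)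

(* Defs.v *)
From mathcomp Require Import all_boot.

Set Implicit Arguments.
Unset Strict Implicit.
Unset Printing Implicit Defensive.

(* Graphs on the vertex set 'I_n.  An undirected edge {u, v} is the set
   [set u; v], so a loop is a singleton; members of E with more than two
   elements, or with none, have no effect. *)
Inductive graph (n : nat) : Type :=
| Directed (E : {set 'I_n * 'I_n})
| Undirected (E : {set {set 'I_n}}).

Definition arc n (G : graph n) (u v : 'I_n) : bool :=
  match G with
  | Directed E => (u, v) \in E
  | Undirected E => [set u; v] \in E
  end.

Definition deg n (G : graph n) (v : 'I_n) : nat := #|[set u | arc G v u]|.

Definition max_deg n (G : graph n) : nat := \max_(v < n) deg G v.

(* The vertices following s on the path are listed in p, so that the number of
   edges is [size p]. *)
Definition path_from_to n (G : graph n) (s t : 'I_n) (p : seq 'I_n) : bool :=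
  path (arc G) s p && (last s p == t).

(* [None] stands for an infinite distance. *)
Definition is_dist n (G : graph n) (s t : 'I_n) (d : option nat) : Prop :=
  match d with
  | Some k => (exists2 p, path_from_to G s t p & size p = k) /\
              (forall p, path_from_to G s t p -> k <= size p)
  | None => forall p, ~~ path_from_to G s t p
  end.

(* The elements of an output sequence are pairs (vertex, distance). *)
Definition sssd_solution n (G : graph n) (s : 'I_n)
    (out : seq (nat * option nat)) : Prop :=
  exists2 d : 'I_n -> option nat,
    forall t, is_dist G s t (d t) &
    perm_eq out [seq (val t, d t) | t <- enum 'I_n].

(* Read-only input.  The adjacency list of v is a linked list whose first node
   is [in_head v]; [in_vertex] and [in_next] give the contents of a node.  The
   nodes may be anywhere in the address space; in particular the lists may be
   laid out as arrays. *)
Record input := Input {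
  in_n : nat;
  in_source : nat;
  in_deg : nat -> nat;
  in_head : nat -> nat;
  in_vertex : nat -> nat;
  in_next : nat -> nat
}.

(* The pointer stored in the last node is unconstrained: the length of the list
   is known from the degree. *)
Fixpoint linked_list (w : nat) (I : input) (p : nat) (l : seq nat) : Prop :=
  if l is v :: l' then
    [/\ p < 2 ^ w, in_vertex I p = v & linked_list w I (in_next I p) l']
  else True.

Definition represents (w n : nat) (I : input) (G : graph n) (s : 'I_n) : Prop :=
  [/\ in_n I = n,
      in_source I = s,
      forall v : 'I_n, in_deg I v = deg G v &
      forall v : 'I_n, exists l : seq 'I_n,
        [/\ uniq l, l =i [pred u | arc G v u] &
            linked_list w I (in_head I v) (map val l)]].

(* Word RAM with word size w.  There are two banks of work memory, one with
   arbitrary initial contents and one lazily initialized; a cell must have been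
   allocated before it is accessed. *)
Inductive binop :=
| OpAdd | OpSub | OpMul | OpDiv | OpMod | OpAnd | OpOr | OpXor | OpShl | OpShr.

Inductive instr :=
| Const (d k : nat)
| Move (d a : nat)
| Bin (o : binop) (d a b : nat)
| Jump (l : nat)
| JumpEq (a b l : nat)
| JumpLt (a b l : nat)
| GetN (d : nat)
| GetSource (d : nat)
| GetDeg (d v : nat)
| GetHead (d v : nat)
| GetVertex (d p : nat)
| GetNext (d p : nat)
| Alloc (d k : nat)       (* d := base of a new block of (contents of k) cells *)
| Read (d a : nat)
| Write (a b : nat)
| LazyAlloc (d k : nat)
| LazyTest (d a : nat)    (* d := 1 if the cell has been written, 0 otherwise *)
| LazyRead (d a : nat)
| LazyWrite (a b : nat)
| Output (v k : nat)
| OutputInfty (v : nat)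
| Halt.

Definition program := seq instr.

Record config := Config {
  pc : nat;
  regs : nat -> nat;
  mem : nat -> nat;
  mem_size : nat;
  lazy : nat -> option nat;
  lazy_size : nat
}.

Inductive outcome :=
| Next (c : config)
| Emit (o : nat * option nat) (c : config)
| Halted
| Fault.

Definition upd (T : Type) (f : nat -> T) (a : nat) (v : T) : nat -> T :=
  fun x => if x == a then v else f x.

Definition eval_binop (w : nat) (o : binop) (a b : nat) : nat :=
  match o with
  | OpAdd => a + b
  | OpSub => a + 2 ^ w - b
  | OpMul => a * b
  | OpDiv => a %/ b
  | OpMod => a %% b
  | OpAnd => Nat.land a b
  | OpOr => Nat.lor a b
  | OpXor => Nat.lxor a b
  | OpShl => a * 2 ^ b
  | OpShr => a %/ 2 ^ b
  end.

Section Step.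
Variables (w : nat) (P : program) (I : input).

Definition goto (c : config) (l : nat) : config :=
  Config l (regs c) (mem c) (mem_size c) (lazy c) (lazy_size c).

Definition set_reg (c : config) (d v : nat) : config :=
  Config (pc c).+1 (upd (regs c) d (v %% 2 ^ w))
         (mem c) (mem_size c) (lazy c) (lazy_size c).

Definition step (c : config) : outcome :=
  let r := regs c in
  match onth P (pc c) with
  | None => Fault
  | Some i =>
    match i with
    | Const d k => Next (set_reg c d k)
    | Move d a => Next (set_reg c d (r a))
    | Bin o d a b => Next (set_reg c d (eval_binop w o (r a) (r b)))
    | Jump l => Next (goto c l)
    | JumpEq a b l => Next (goto c (if r a == r b then l else (pc c).+1))
    | JumpLt a b l => Next (goto c (if r a < r b then l else (pc c).+1))
    | GetN d => Next (set_reg c d (in_n I))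
    | GetSource d => Next (set_reg c d (in_source I))
    | GetDeg d v => Next (set_reg c d (in_deg I (r v)))
    | GetHead d v => Next (set_reg c d (in_head I (r v)))
    | GetVertex d p => Next (set_reg c d (in_vertex I (r p)))
    | GetNext d p => Next (set_reg c d (in_next I (r p)))
    | Alloc d k =>
        if mem_size c + r k <= 2 ^ w then
          let c' := set_reg c d (mem_size c) in
          Next (Config (pc c') (regs c') (mem c') (mem_size c + r k)
                       (lazy c') (lazy_size c'))
        else Fault
    | Read d a =>
        if r a < mem_size c then Next (set_reg c d (mem c (r a))) else Fault
    | Write a b =>
        if r a < mem_size c then
          Next (Config (pc c).+1 r (upd (mem c) (r a) (r b)) (mem_size c)
                       (lazy c) (lazy_size c))
        else Fault
    | LazyAlloc d k =>
        if lazy_size c + r k <= 2 ^ w then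
          let c' := set_reg c d (lazy_size c) in
          Next (Config (pc c') (regs c') (mem c') (mem_size c')
                       (lazy c') (lazy_size c + r k))
        else Fault
    | LazyTest d a =>
        if r a < lazy_size c then Next (set_reg c d (isSome (lazy c (r a))))
        else Fault
    | LazyRead d a =>
        if r a < lazy_size c then
          if lazy c (r a) is Some v then Next (set_reg c d v) else Fault
        else Fault
    | LazyWrite a b =>
        if r a < lazy_size c then
          Next (Config (pc c).+1 r (mem c) (mem_size c)
                       (upd (lazy c) (r a) (Some (r b))) (lazy_size c))
        else Fault
    | Output v k => Emit (r v, Some (r k)) (goto c (pc c).+1)
    | OutputInfty v => Emit (r v, None) (goto c (pc c).+1)
    | Halt => Halted
    end
  end.

(* [run c delays out cf]: started in c, the program outputs the sequence out
   and then halts in cf without having faulted.  The list delays, of size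
   (size out).+1, contains the number of instructions executed until the first
   output, between consecutive outputs, and after the last output up to and
   including [Halt]. *)
Inductive run : config -> seq nat -> seq (nat * option nat) -> config -> Prop :=
| RunHalt c :
    step c = Halted -> run c [:: 1] [::] c
| RunNext c c' d ds out cf :
    step c = Next c' -> run c' (d :: ds) out cf ->
    run c (d.+1 :: ds) out cf
| RunEmit c c' o ds out cf :
    step c = Emit o c' -> run c' ds out cf ->
    run c (1 :: ds) (o :: out) cf.

End Step.

Definition init (mem0 : nat -> nat) : config :=
  Config 0 (fun _ => 0) mem0 0 (fun _ => None) 0.

Definition instr_regs (i : instr) : seq nat :=
  match i with
  | Jump _ | Halt => [::]
  | Const d _ | GetN d | GetSource d | OutputInfty d => [:: d]
  | Bin _ d a b => [:: d; a; b]
  | Move a b | JumpEq a b _ | JumpLt a b _ | GetDeg a b | GetHead a b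
  | GetVertex a b | GetNext a b | Alloc a b | Read a b | Write a b
  | LazyAlloc a b | LazyTest a b | LazyRead a b | LazyWrite a b
  | Output a b => [:: a; b]
  end.

Definition num_regs (P : program) : nat :=
  size (undup (flatten (map instr_regs P))).

(* Work space in words.  Memory is never released, so the sizes in the final
   configuration are the largest ones.  A lazily initialized cell costs three
   words: an entry of the array of pointer/value pairs and an entry of the
   auxiliary array that validates it; one more word is the counter. *)
Definition space (P : program) (c : config) : nat :=
  num_regs P + mem_size c + 3 * lazy_size c + 1.

(* Main.v *)
From mathcomp Require Import all_boot zify.
Require Import Defs.

Set Implicit Arguments.
Unset Strict Implicit.
Unset Printing Implicit Defensive.

(* Breadth-first search in which the queue and the set of visited vertices share
   one array, a permutation of the vertices kept together with its inverse:
   the first t entries are the visited vertices in order of discovery, and a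
   vertex is discovered by exchanging it with the entry at position t.  A missing
   cell of the lazily initialized memory is read as the identity permutation, so
   no initialization is needed.  When the search ends, the unreachable vertices
   are exactly the entries from position t on, hence they can be output with
   constant delay without skipping over visited ones. *)

(** * Balls around the source and the breadth-first invariant *)

Section Distance.
Variables (n : nat) (G : graph n) (s : 'I_n).

Fixpoint ball (k : nat) : {set 'I_n} :=
  if k is k'.+1
  then ball k' :|: [set v | [exists u in ball k', arc G u v]]
  else [set s].

Lemma ballSP k v :
  reflect (v \in ball k \/ exists2 u, u \in ball k & arc G u v)
          (v \in ball k.+1).
Proof.
rewrite /= in_setU inE; apply: (iffP orP) => -[]; first by left.
- by move/exists_inP=> [u uk uv]; right; exists u.
- by left.
- by move=> [u uk uv]; right; apply/exists_inP; exists u.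
Qed.

Lemma ball_mono j k : j <= k -> {subset ball j <= ball k}.
Proof.
move=> /subnK <-; elim: (k - j) => [//|i IH] v /IH vi.
by rewrite addSn; apply/ballSP; left.
Qed.

Lemma ball_path p v : path_from_to G s v p -> v \in ball (size p).
Proof.
case/andP; elim/last_ind: p v => [|p x IH] v /=; first by move=> _ /eqP->; rewrite inE.
rewrite rcons_path last_rcons size_rcons => /andP[sp px] /eqP<-.
by apply/ballSP; right; exists (last s p); first exact: IH.
Qed.

Lemma path_ball k v :
  v \in ball k -> exists2 p, path_from_to G s v p & size p <= k.
Proof.
elim: k v => [|k IH] v.
  by rewrite inE => /eqP->; exists [::]; rewrite /path_from_to /=.
case/ballSP => [/IH[p sp pk]|[u /IH[p /andP[sp /eqP pu] pk] uv]].
  by exists p => //; apply: leqW.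
by exists (rcons p v); rewrite ?size_rcons // /path_from_to rcons_path sp pu uv last_rcons eqxx.
Qed.

Lemma is_dist_SomeP v k :
  is_dist G s v (Some k) <->
  v \in ball k /\ (forall j, j < k -> v \notin ball j).
Proof.
split=> [[[p sp <-] pmin]|[vk kmin]].
  split; first exact: ball_path.
  move=> j jp; apply/negP => /path_ball[q /pmin pq qj].
  by move: (leq_trans pq qj); rewrite leqNgt jp.
have lek q : path_from_to G s v q -> k <= size q.
  move=> /ball_path vq; rewrite leqNgt; apply/negP => /kmin.
  by rewrite vq.
have [p sp pk] := path_ball vk.
by split=> //; exists p => //; apply/eqP; rewrite eqn_leq pk lek.
Qed.

Lemma is_dist_NoneP v : is_dist G s v None <-> forall k, v \notin ball k.
Proof.
split=> H; first by move=> k; apply/negP => /path_ball[p]; rewrite (negPf (H p)).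
by move=> p; apply/negP => /ball_path; rewrite (negPf (H _)).
Qed.

Lemma is_dist_unique v d d' : is_dist G s v d -> is_dist G s v d' -> d = d'.
Proof.
case: d d' => [k|] [k'|] //.
- move=> [[p sp <-] pm] [[q sq <-] qm]; congr Some.
  by apply/eqP; rewrite eqn_leq pm // qm.
- by move=> [[p sp _] _] /(_ p); rewrite sp.
- by move=> H [[p sp _] _]; move: (H p); rewrite sp.
Qed.

(** Every path shortens to one without repeated vertices, which has fewer than [n] edges, so
    [ball n] already decides reachability. *)
Lemma dist_exists :
  exists d : 'I_n -> option nat, forall v, is_dist G s v (d v).
Proof.
apply: (@fin_all_exists _ (fun=> option nat)) => v.
have [vn|vn] := boolP (v \in ball n).
  have exk : exists k, v \in ball k by exists n.
  exists (Some (ex_minn exk)); apply/is_dist_SomeP.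
  case: ex_minnP => k vk kmin; split=> // j jk.
  by apply/negP => /kmin; rewrite leqNgt jk.
exists None => p; apply/negP => /andP[sp /eqP pv]; move: sp pv.
case/shortenP => q sq uq _ qv; case/negP: vn.
apply: (@ball_mono (size q)); last by apply: ball_path; rewrite /path_from_to sq qv eqxx.
by have := max_card [in s :: q]; rewrite (card_uniqP uq) card_ord; apply: ltnW.
Qed.

(* The queue is the part of [vis] from position [h] on; [e] is the end of the
   level at distance [k], and earlier positions hold finished vertices. *)
Record bfs (vis : seq 'I_n) (h e k : nat) : Prop := Bfs {
  bfs_he : h <= e;
  bfs_e : e <= size vis;
  bfs_k : k < e;
  bfs_level : take e vis =i ball k;
  bfs_mem : forall v, v \in vis = (v \in ball k) || has (arc G ^~ v) (take h vis);
  bfs_done : forall j, j < k -> {subset ball j <= take h vis}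
}.

Lemma bfs_init : bfs [:: s] 0 1 0.
Proof. by split=> //= v; rewrite ?inE ?orbF. Qed.

(** Smaller balls consist of finished vertices, and [uniq vis] keeps the head of the queue out of
    the finished prefix. *)
Lemma bfs_dist vis h e k :
  uniq vis -> bfs vis h e k -> h < e ->
  is_dist G s (nth s vis h) (Some k).
Proof.
move=> uv [he ev ke lev _ don] lt_he.
have hv : h < size vis by apply: leq_trans ev.
apply/is_dist_SomeP; split.
  by rewrite -lev -(nth_take _ lt_he) mem_nth // size_takel.
move=> j jk; apply/negP => /(don j jk).
by move: uv; rewrite -{1}(cat_take_drop h vis) (drop_nth s hv) cat_uniq /=
  negb_or => /and3P[_ /andP[/negPf-> _] _].
Qed.

(** Discoveries are appended behind position [e], so the current level and the finished prefix are
    undisturbed. *)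
Lemma bfs_scan vis new h e k :
  bfs vis h e k -> h < e ->
  vis ++ new =i [predU vis & arc G (nth s vis h)] ->
  bfs (vis ++ new) h.+1 e k.
Proof.
move=> [he ev ke lev mv don] lt_he mem'.
have hv : h < size vis by apply: leq_trans ev.
have tk i : i <= size vis -> take i (vis ++ new) = take i vis.
  move=> iv; rewrite take_cat; case: ltngtP iv => // -> _.
  by rewrite subnn take0 cats0 take_size.
split=> // [|v|v|j jk v vj].
- by rewrite size_cat; apply: leq_trans ev (leq_addr _ _).
- by rewrite tk // lev.
- rewrite mem' tk // (take_nth s hv) -cats1 has_cat /= orbF.
  by rewrite [LHS]inE /= mv orbA.
- by rewrite tk // (take_nth s hv) mem_rcons inE (don j jk v vj) orbT.
Qed.

Lemma bfs_level_end vis e k : bfs vis e e k -> vis =i ball k.+1.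
Proof.
move=> [_ ev ke lev mv don] v; rewrite mv /= in_setU inE; congr orb.
apply/hasP/exists_inP => -[u uk uv]; exists u => //.
  by rewrite -lev.
by rewrite lev.
Qed.

Lemma bfs_next_level vis e k :
  bfs vis e e k -> e < size vis -> bfs vis e (size vis) k.+1.
Proof.
move=> B ev; have bv := bfs_level_end B; case: B => [_ _ ke lev mv don].
split=> // [||v|v|j jk v vj].
- exact: ltnW.
- exact: leq_ltn_trans ke ev.
- by rewrite take_size bv.
(* The scanned vertices are those of [ball k], so their out-neighbours already lie in [ball k.+1]
   and the [has] clause adds nothing. *)
- rewrite bv; case: (boolP (v \in ball k.+1)) => //= vk; apply/esym/hasPn => u.
  rewrite lev => uk; apply: contra vk => uv; apply/ballSP; right.
  by exists u.
- by rewrite lev; apply: ball_mono vj.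
Qed.

(** A level that discovers nothing makes [ball k] and [ball k.+1] coincide; the balls are then
    stationary and [vis] contains all of them. *)
Lemma bfs_unreachable vis k v :
  bfs vis (size vis) (size vis) k -> v \notin vis -> is_dist G s v None.
Proof.
move=> B vv; have bv := bfs_level_end B.
have bk u : u \in ball k = (u \in vis) by rewrite -(bfs_level B) take_size.
have bfix j : {subset ball j <= vis}.
  elim: j => [|j IH] u uj; first by rewrite -bk (ball_mono (leq0n k)).
  case/ballSP: uj => [/IH//|[x /IH xv xu]]; rewrite bv; apply/ballSP; right.
  by exists x; rewrite ?bk.
by apply/is_dist_NoneP => j; apply: contra vv => /bfix.
Qed.

End Distance.

(** * The lazily initialized permutation and its inverse *)

Section Table.
Variable n : nat.
Implicit Types (lz : nat -> option nat) (vis : seq 'I_n) (v : 'I_n).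

Definition order_at lz i := odflt i (lz i).
Definition rank_of lz i := odflt i (lz (n + i)).

(** [vis] is a ghost value: the machine holds only its length, and its entries are read off the
    memory. *)
Record table lz vis : Prop := Table {
  order_lt : forall i, i < n -> order_at lz i < n;
  rank_lt : forall i, i < n -> rank_of lz i < n;
  order_rank : forall i, i < n -> order_at lz (rank_of lz i) = i;
  rank_order : forall i, i < n -> rank_of lz (order_at lz i) = i;
  table_uniq : uniq vis;
  table_vis : map val vis = mkseq (order_at lz) (size vis)
}.

Lemma table_init : table (fun=> None) [::].
Proof. by []. Qed.

Lemma table_size lz vis : table lz vis -> size vis <= n.
Proof.
by move=> H; have := max_card [in vis]; rewrite (card_uniqP (table_uniq H)) card_ord.
Qed.

Lemma table_nth lz vis v0 i :
  table lz vis -> i < size vis -> order_at lz i = nth v0 vis i.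
Proof.
by move=> H iv; rewrite -(nth_map v0 0 val) // (table_vis H) nth_mkseq.
Qed.

Lemma table_mem lz vis v :
  table lz vis -> (v \in vis) = (rank_of lz v < size vis).
Proof.
move=> H; apply/idP/idP => [vv|rv].
  have iv : index v vis < size vis by rewrite index_mem.
  have /= := table_nth v H iv; rewrite nth_index // => <-.
  by rewrite (rank_order H) //; apply: leq_trans iv (table_size H).
have := table_nth v H rv; rewrite (order_rank H) // => /val_inj ->.
exact: mem_nth.
Qed.

(** Extends the prefix without touching memory; this serves after an exchange and also when the
    unreachable vertices are listed. *)
Lemma table_rcons lz vis v :
  table lz vis -> order_at lz (size vis) = v -> size vis < n ->
  table lz (rcons vis v).
Proof.
move=> H Av lt_n; case: (H) => ol rl orr ro uv tv; split=> //.
  by rewrite rcons_uniq uv andbT (table_mem _ H) -Av ro // ltnn.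
by rewrite map_rcons size_rcons mkseqS tv /= Av.
Qed.

Lemma table_full lz vis : table lz vis -> size vis = n -> perm_eq vis (enum 'I_n).
Proof.
move=> H sz; apply: uniq_perm; rewrite ?enum_uniq ?(table_uniq H) // => v.
by rewrite (table_mem _ H) sz mem_enum inE (rank_lt H).
Qed.

(** No test for [p = t] is required: then [u = v], and the last two writes repeat the first two. *)
Definition swap_in lz (t v : nat) :=
  let p := rank_of lz v in let u := order_at lz t in
  upd (upd (upd (upd lz t (Some v)) (n + v) (Some t)) p (Some u)) (n + u) (Some p).

(** The exchanged positions both lie outside the visited prefix, so the prefix survives and [v]
    arrives just behind it. *)
Lemma table_visit lz vis v :
  table lz vis -> v \notin vis ->
  table (swap_in lz (size vis) v) (rcons vis v).
Proof.
move=> H; rewrite (table_mem _ H) -leqNgt => le_t.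
have pn := rank_lt H (ltn_ord v).
have tn : size vis < n by apply: leq_ltn_trans pn.
have un := order_lt H tn.
set t := size vis in le_t tn un *; set lz' := swap_in _ _ _.
have Ae i : i < n -> order_at lz' i =
    if i == rank_of lz v then order_at lz t else
    if i == t then v : nat else order_at lz i.
  move=> lt_i; rewrite /order_at /lz' /swap_in /upd.
  (* Order cells lie below [n] and rank cells from [n] on, so writes of one kind never affect the
     other. *)
  have E x : (i == n + x) = false by lia.
  by rewrite !E; do 2 case: ifP => //.
have Be i : i < n -> rank_of lz' i =
    if i == order_at lz t then rank_of lz v else
    if i == v then t else rank_of lz i.
  move=> lt_i; rewrite /rank_of /lz' /swap_in /upd !eqn_add2l.
  have -> : (n + i == t) = false by lia.
  rewrite -/(rank_of lz v).
  have -> : (n + i == rank_of lz v) = false by lia.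
  by do 2 case: ifP => //.
have Ap := order_rank H (ltn_ord v).
have Bu := rank_order H tn.
have H' : table lz' vis.
  split=> [i lt_i|i lt_i|i lt_i|i lt_i||].
  - by rewrite Ae //; do 2 case: ifP => // _; apply: (order_lt H).
  - by rewrite Be //; do 2 case: ifP => // _; apply: (rank_lt H).
  - rewrite Be //; case: eqP => [->|iu].
      by rewrite Ae // eqxx.
    case: eqP => [->|iv].
      rewrite Ae // eqxx; case: eqP => // tp; by rewrite tp Ap.
    rewrite Ae ?(rank_lt H) //; case: eqP => [e|_].
      by move: (order_rank H lt_i); rewrite e Ap; lia.
    case: eqP => [e|_]; last exact: (order_rank H).
    by move: (order_rank H lt_i); rewrite e; lia.
  - rewrite Ae //; case: eqP => [->|ip]; first by rewrite Be // eqxx.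
    case: eqP => [->|it].
      rewrite Be // eqxx; case: eqP => // vu; by rewrite vu Bu.
    rewrite Be ?(order_lt H) //; case: eqP => [e|_].
      by move: (rank_order H lt_i); rewrite e Bu; lia.
    case: eqP => [e|_]; last exact: (rank_order H).
    by move: (rank_order H lt_i); rewrite e; lia.
  - exact: table_uniq H.
  - rewrite (table_vis H); apply/eq_in_map => i; rewrite mem_iota /= add0n => lt_i.
    rewrite Ae; last by apply: ltn_trans tn.
    by rewrite !ifF //; rewrite -/t in lt_i; lia.
apply: table_rcons => //; rewrite Ae // eqxx -/t.
by case: eqP => // {1}->; rewrite Ap.
Qed.

End Table.

(** * The machine code *)

Definition main_pc := 7.
Definition dequeue_pc := 11.
Definition scan_pc := 19.
Definition visit_pc := 23.
Definition rest_pc := 40.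
Definition halt_pc := 48.

(* Registers: 0 and 1 hold these constants, 2 is n, 3 the number t of visited
   vertices, 4 the head h of the queue, 5 the end e of the current level,
   6 its distance k, 7 the list pointer, 8 the number of nodes left in the
   list, 9 the vertex at hand, 10 the address of its rank, 11 and 12 the rank
   p and the vertex u exchanged with it, 13 and 14 scratch.  The lazy cell i
   holds the vertex of rank i and the lazy cell n + v the rank of v; a missing
   cell stands for the identity. *)
Definition sssd_program : program := [::
  GetN 2; Const 1 1; Bin OpAdd 14 2 2; LazyAlloc 10 14; Const 5 1; GetSource 9;
  Jump visit_pc;
  (* main_pc *)
  JumpLt 4 5 dequeue_pc; JumpEq 5 3 rest_pc; Move 5 3; Bin OpAdd 6 6 1;
  (* dequeue_pc *)
  Move 9 4; LazyTest 13 4; JumpEq 13 0 15; LazyRead 9 4;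
  Output 9 6; Bin OpAdd 4 4 1; GetDeg 8 9; GetHead 7 9;
  (* scan_pc *)
  JumpEq 8 0 main_pc; GetVertex 9 7; GetNext 7 7; Bin OpSub 8 8 1;
  (* visit_pc *)
  Bin OpAdd 10 2 9;
  Move 11 9; LazyTest 13 10; JumpEq 13 0 28; LazyRead 11 10;
  JumpLt 11 3 scan_pc;
  Move 12 3; LazyTest 13 3; JumpEq 13 0 33; LazyRead 12 3;
  LazyWrite 3 9; LazyWrite 10 3; LazyWrite 11 12; Bin OpAdd 10 2 12;
  LazyWrite 10 11; Bin OpAdd 3 3 1; Jump scan_pc;
  (* rest_pc *)
  JumpEq 3 2 halt_pc; Move 9 3; LazyTest 13 3; JumpEq 13 0 45; LazyRead 9 3;
  OutputInfty 9; Bin OpAdd 3 3 1; Jump rest_pc;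
  (* halt_pc *)
  Halt].

Lemma updE (T : Type) (f : nat -> T) a v x :
  upd f a v x = if x == a then v else f x.
Proof. by []. Qed.

(** * A program logic for delays *)

Section Timed.
Variables (w : nat) (I : input) (P : program) (D : nat).
Implicit Types (c : config) (Q : seq (nat * option nat) -> config -> Prop).

(* From [c] the next output, or the halt, comes within [b] instructions, and
   every later delay is at most [D]. *)
Definition timed (b : nat) c Q : Prop :=
  exists d ds out cf,
    [/\ run w P I c (d :: ds) out cf, d <= b, all (fun d => d <= D) ds &
        Q out cf].

Lemma timed_mono b b' c Q Q' :
  (forall out cf, Q out cf -> Q' out cf) -> b <= b' ->
  timed b c Q -> timed b' c Q'.
Proof.
move=> QQ' bb' [x [ds [out [cf [H xb HD HQ]]]]]; exists x, ds, out, cf.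
by split=> //; [apply: leq_trans bb'|apply: QQ'].
Qed.

Lemma timed_weaken b b' c Q : b <= b' -> timed b c Q -> timed b' c Q.
Proof. exact: timed_mono. Qed.

Lemma timed_next b c c' Q :
  step w P I c = Next c' -> timed b c' Q -> timed b.+1 c Q.
Proof.
move=> Hs [d [ds [out [cf [H db HD HQ]]]]]; exists d.+1, ds, out, cf.
by split=> //; apply: RunNext H.
Qed.

(** An output closes the current delay, so the continuation starts afresh with the full budget
    [D]. *)
Lemma timed_emit b c c' o Q :
  step w P I c = Emit o c' -> timed D c' (fun out => Q (o :: out)) ->
  timed b.+1 c Q.
Proof.
move=> Hs [d [ds [out [cf [H db HD HQ]]]]]; exists 1, (d :: ds), (o :: out), cf.
by split=> //=; [apply: RunEmit H|apply/andP].
Qed.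

Lemma timed_halt b c Q : step w P I c = Halted -> Q [::] c -> timed b.+1 c Q.
Proof.
by move=> Hs HQ; exists 1, [::], [::], c; split=> //; apply: RunHalt.
Qed.

(** Replaces the wrapped word by the intended value [v'], so that later reasoning is free of modular
    arithmetic. *)
Lemma timed_set b c d v v' Q :
  step w P I c = Next (set_reg w c d v) -> v = v' %[mod 2 ^ w] -> v' < 2 ^ w ->
  timed b (Config (pc c).+1 (upd (regs c) d v') (mem c) (mem_size c)
                  (lazy c) (lazy_size c)) Q ->
  timed b.+1 c Q.
Proof.
move=> Hs vv' lt_v' H; apply: timed_next Hs _.
by rewrite /set_reg vv' modn_small.
Qed.

Lemma timed_write b p r m ms lz ls a v Q :
  onth P p = Some (LazyWrite a v) -> r a < ls ->
  timed b (Config p.+1 r m ms (upd lz (r a) (Some (r v))) ls) Q ->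
  timed b.+1 (Config p r m ms lz ls) Q.
Proof.
by move=> HP ra; apply: timed_next; rewrite /step HP /= ra.
Qed.

(** The recurring idiom of reading a lazy cell with default [r x]; the abstract [r'] hides the
    scratch register 13. *)
Lemma timed_load b p d x a r m ms lz ls Q :
  onth P p = Some (Move d x) -> onth P p.+1 = Some (LazyTest 13 a) ->
  onth P p.+2 = Some (JumpEq 13 0 p.+4) -> onth P p.+3 = Some (LazyRead d a) ->
  [&& a != d, a != 13, d != 0 & d != 13] -> 1 < 2 ^ w ->
  r 0 = 0 -> r a < ls -> r x < 2 ^ w -> odflt (r x) (lz (r a)) < 2 ^ w ->
  (forall r', r' d = odflt (r x) (lz (r a)) ->
     (forall i, i != d -> i != 13 -> r' i = r i) ->
     timed b (Config p.+4 r' m ms lz ls) Q) ->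
  timed b.+4 (Config p r m ms lz ls) Q.
Proof.
move=> P0 P1 P2 P3 /and4P[ad a13 d0 d13] w1 r0 ra rx rv H.
apply: (@timed_set _ _ d (r x) (r x)) => //=; first by rewrite /step P0.
have E0 : upd r d (r x) 0 = 0 by rewrite /upd eq_sym (negPf d0).
have Ea : upd r d (r x) a = r a by rewrite /upd (negPf ad).
apply: (@timed_set _ _ 13 (isSome (lz (r a))) (isSome (lz (r a)))) => //=.
- by rewrite /step P1 /= Ea ra.
- by case: (isSome _); rewrite // ltnW.
have Ea' z : upd (upd r d (r x)) 13 z a = r a by rewrite {1}/upd (negPf a13) Ea.
have EJ z : (upd (upd r d (r x)) 13 z 13 == upd (upd r d (r x)) 13 z 0) = (z == 0).
  by rewrite -[upd _ 13 z 0]/(upd r d (r x) 0) E0.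
case lza : (lz (r a)) rv H => [v|] /= rv H; last first.
  apply: timed_next; first by rewrite /step P2.
  (* An unwritten cell skips the read, so one instruction of the budget is left over. *)
  rewrite EJ /goto /=; apply: timed_weaken (leqnSn _) (H _ _ _).
    by rewrite /upd (negPf d13) eqxx.
  by move=> i id i13; rewrite /upd (negPf id) (negPf i13).
apply: timed_next; first by rewrite /step P2.
rewrite EJ; apply: (@timed_set _ _ d v v) => //=.
  by rewrite /step P3 /= Ea' ra lza.
apply: H; first by rewrite /upd eqxx.
by move=> i id i13; rewrite /upd (negPf id) (negPf i13).
Qed.

End Timed.

(** * Correctness and delay of the code *)

Section Correctness.
Variables (n : nat) (G : graph n) (s : 'I_n) (w : nat) (I : input) (m : nat -> nat).
Implicit Types (vis l : seq 'I_n) (v : 'I_n).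
Hypothesis w_large : 2 * n + 1 < 2 ^ w.
Hypothesis HI : represents w I G s.

(** Leaves slack: between two outputs, a list node costs at most 21 instructions and everything else
    at most 16. *)
Let D := 22 * max_deg G + 40.

Local Notation timed := (timed w I sssd_program D).
Local Notation state p r lz := (Config p r m 0 lz (n + n)).

Record frame (r : nat -> nat) (t h e k : nat) : Prop := Frame {
  frame0 : r 0 = 0; frame1 : r 1 = 1; frame2 : r 2 = n; frame3 : r 3 = t;
  frame4 : r 4 = h; frame5 : r 5 = e; frame6 : r 6 = k
}.

(** The budget of 17 is the length of the discovering branch; for a visited vertex the rank
    comparison leaves after at most 6. *)
Lemma timed_visit b r lz vis (v : 'I_n) h e k Q :
  table lz vis -> frame r (size vis) h e k -> r 9 = v ->
  (forall r' lz' vis', vis' = (if v \in vis then vis else rcons vis v) ->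
     table lz' vis' -> frame r' (size vis') h e k -> r' 7 = r 7 -> r' 8 = r 8 ->
     timed b (state scan_pc r' lz') Q) ->
  timed b.+4.+4.+4.+4.+1 (state visit_pc r lz) Q.
Proof.
move=> T [r0 r1 r2 r3 r4 r5 r6] r9 H.
have lt_v := ltn_ord v; have sz := table_size T.
have rk := rank_lt T lt_v.
apply: (timed_set (v' := n + v)); [reflexivity|by rewrite /= r2 r9|lia|].
apply: (timed_load (d := 11) (x := 9) (a := 10)); rewrite //= ?updE /= ?r9.
1-3: lia.
  by rewrite -/(rank_of n lz v); lia.
rewrite -/(rank_of n lz v) => q q11 Fq.
case: (boolP (v \in vis)) => vv.
  have rv : rank_of n lz v < size vis by rewrite -(table_mem _ T).
  apply: timed_next; first reflexivity.
  rewrite /goto /= q11 Fq //= ?updE /= r3 rv.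
  have {}H := H q lz vis; rewrite vv !Fq //= ?updE /= in H.
  apply: timed_weaken (H _ _ _ _ _) => //; first lia.
  by split; rewrite Fq.
have rv : (rank_of n lz v < size vis) = false.
  by apply/negbTE; rewrite -(table_mem _ T).
have lt_t : size vis < n by lia.
apply: timed_next; first reflexivity.
rewrite /goto /= q11 Fq //= ?updE /= r3 rv.
have lt_u := order_lt T lt_t.
apply: (timed_load (d := 12) (x := 3) (a := 3)); rewrite //= ?Fq //= ?updE /= ?r3.
1-3: lia.
  by rewrite -/(order_at lz (size vis)); lia.
rewrite -/(order_at lz (size vis)) => g g12 Fg.
have g3 : g 3 = size vis by rewrite Fg ?Fq.
have g9 : g 9 = v by rewrite Fg ?Fq.
have g10 : g 10 = n + v by rewrite Fg ?Fq.
have g11 : g 11 = rank_of n lz v by rewrite Fg.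
have g2 : g 2 = n by rewrite Fg ?Fq.
apply: timed_write; rewrite ?g3 ?g9 //; first lia.
apply: timed_write; rewrite ?g10 ?g3 //; first lia.
apply: timed_write; rewrite ?g11 ?g12 //; first lia.
apply: (timed_set (v' := n + order_at lz (size vis)));
  [reflexivity|by rewrite /= g2 g12|lia|].
rewrite /=; apply: timed_write; rewrite // ?updE /= ?g11; first lia.
apply: (timed_set (v' := (size vis).+1));
  [reflexivity|by rewrite /= ?updE /= g3 Fg ?Fq //= ?updE /= r1 addn1|lia|].
apply: timed_next; first reflexivity.
rewrite /goto /=; apply: H (table_visit T vv) _ _ _ => //.
- by rewrite (negPf vv).
- by split; rewrite /= ?updE /= ?size_rcons // Fg ?Fq.
- by rewrite /= ?updE /= Fg ?Fq.
- by rewrite /= ?updE /= Fg ?Fq.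
Qed.

(** Truncation to a word can alter only the unconstrained pointer of the last node, after which the
    list is empty. *)
Lemma linked_list_mod p (l : seq nat) :
  linked_list w I p l -> linked_list w I (p %% 2 ^ w) l.
Proof. by case: l => //= v l [lt_p pv nl]; rewrite modn_small. Qed.

Lemma timed_scan b l r lz vis h e k Q :
  table lz vis -> frame r (size vis) h e k ->
  size l < 2 ^ w -> linked_list w I (r 7) (map val l) -> r 8 = size l ->
  (forall r' lz' new, vis ++ new =i [predU vis & l] -> table lz' (vis ++ new) ->
     frame r' (size (vis ++ new)) h e k -> timed b (state main_pc r' lz') Q) ->
  timed (21 * size l + b.+1) (state scan_pc r lz) Q.
Proof.
elim: l r lz vis => [|v l IH] r lz vis T F lt_l /=.
  move=> _ r8 H; apply: timed_next; first reflexivity.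
  rewrite /goto /= r8 (frame0 F) /=; apply: (H _ _ [::]); rewrite ?cats0 // => u.
  by rewrite !inE orbF.
move=> [lt_p pv nl] r8 H; have lt_v := ltn_ord v.
(* Per node, 4 instructions of the loop and 17 of the visit. *)
have -> : 21 * (size l).+1 + b.+1 = (21 * size l + b.+1).+4.+4.+4.+4.+1.+4 by lia.
case: (F) => r0 r1 r2 r3 r4 r5 r6.
apply: timed_next; first reflexivity; rewrite /goto /= r8 r0 /=.
apply: (timed_set (v' := v)); [reflexivity|by rewrite /= pv|lia|].
apply: (timed_set (v' := in_next I (r 7) %% 2 ^ w)) => /=.
- reflexivity.
- by rewrite /= ?updE /= modn_mod.
- by rewrite ltn_pmod // expn_gt0.
apply: (timed_set (v' := size l)) => /=.
- reflexivity.
(* Machine subtraction adds [2 ^ w] first; the surplus vanishes modulo [2 ^ w]. *)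
- by rewrite /= ?updE /= r8 r1 -addnBA ?expn_gt0 // addSn -addnS subn1 prednK
    ?expn_gt0 // modnDr.
- by apply: ltn_trans lt_l.
apply: (timed_visit (v := v) (vis := vis) T (h := h) (e := e) (k := k)).
- by split; rewrite /= ?updE.
- by [].
move=> r' lz' vis' vis'E T' F' r'7 r'8; apply: IH T' F' _ _ _ _.
- by apply: ltn_trans lt_l.
- by rewrite r'7; apply: linked_list_mod.
- by rewrite r'8.
have [new0 vE] : exists new0, vis' = vis ++ new0.
  rewrite vis'E; case: ifP => _; first by exists [::]; rewrite cats0.
  by exists [:: v]; rewrite cats1.
move=> r'' lz'' new; rewrite vE -catA => memn; apply: H => u.
rewrite memn !inE -vE vis'E; case: ifP => vv; last by rewrite mem_rcons inE orbCA orbA.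
by case: eqP => // ->; rewrite vv.
Qed.

Variable d : 'I_n -> option nat.
Hypothesis d_dist : forall v, is_dist G s v (d v).

Definition report (v : 'I_n) : nat * option nat := (val v, d v).

(** Past outputs are recovered from [vis], the vertices reported so far; [out] holds only those
    still to come. *)
Definition solved (vis : seq 'I_n) (out : seq (nat * option nat)) (cf : config) :=
  [/\ sssd_solution G s (map report vis ++ out), mem_size cf = 0 &
      lazy_size cf = n + n].

Lemma solved_cons vis v out cf :
  solved (rcons vis v) out cf -> solved vis (report v :: out) cf.
Proof. by rewrite /solved map_rcons cat_rcons. Qed.

(** Register 3 turns from a count of visited vertices into a count of reported ones: each remaining
    entry joins the prefix without an exchange. *)
Lemma timed_rest r lz vis h e k :
  table lz vis -> frame r (size vis) h e k ->
  (forall v, v \notin vis -> d v = None) ->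
  timed 6 (state rest_pc r lz) (solved vis).
Proof.
move En: (n - size vis) => i; elim: i => [|i IH] in r vis En *.
all: move=> T [r0 r1 r2 r3 r4 r5 r6] Hd; have sz := table_size T.
all: apply: timed_next; first reflexivity.
all: rewrite /goto /= r3 r2.
  have szE : size vis = n by lia.
  rewrite szE eqxx; apply: timed_halt; first reflexivity.
  split=> //; exists d => //; rewrite cats0.
  exact: perm_map (table_full T szE).
have lt_t : size vis < n by lia.
have lt_u := order_lt T lt_t.
rewrite ltn_eqF //.
apply: (timed_load (d := 9) (x := 3) (a := 3)); rewrite //= ?r3.
1-3: lia.
  by rewrite -/(order_at lz (size vis)); lia.
rewrite -/(order_at lz (size vis)) => q q9 Fq.
pose v := Ordinal lt_u.
have vv : v \notin vis.
  by rewrite (table_mem _ T) /= (rank_order T) // ltnn.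
apply: timed_emit; first reflexivity.
rewrite /goto /= q9.
apply: (timed_mono (b := 8) (Q := solved (rcons vis v))).
- by move=> out cf /solved_cons; rewrite /report Hd.
- by rewrite /D; lia.
apply: (timed_set (v' := (size vis).+1));
  [reflexivity|by rewrite /= !Fq // r3 r1 addn1|lia|].
apply: timed_next; first reflexivity.
apply: IH.
- by rewrite size_rcons; lia.
- exact: table_rcons.
- by split; rewrite /= ?updE /= ?size_rcons ?Fq.
- by move=> u; rewrite mem_rcons inE negb_or => /andP[_ /Hd].
Qed.

Lemma max_deg_ge v : deg G v <= max_deg G.
Proof. exact: leq_bigmax. Qed.

(** The vertex is output before its list is scanned, so the scan is charged to the next delay. The
    return to the main loop is a premise, to be supplied by induction. *)
Lemma timed_dequeue r lz vis h e k :
  table lz vis -> frame r (size vis) h e k -> bfs G s vis h e k -> h < e ->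
  (forall r' lz' vis', take h.+1 vis' = rcons (take h vis) (nth s vis h) ->
     table lz' vis' -> frame r' (size vis') h.+1 e k ->
     bfs G s vis' h.+1 e k ->
     timed 12 (state main_pc r' lz') (solved (take h.+1 vis'))) ->
  timed 5 (state dequeue_pc r lz) (solved (take h vis)).
Proof.
move=> T [r0 r1 r2 r3 r4 r5 r6] B lt_he H.
have sz := table_size T.
have lt_hv : h < size vis := leq_trans lt_he (bfs_e B).
apply: (timed_load (d := 9) (x := 4) (a := 4)); rewrite //= ?r4.
1-3: lia.
  rewrite -/(order_at lz h); have := order_lt T (leq_trans lt_hv sz); lia.
rewrite -/(order_at lz h) (table_nth s T lt_hv) => q q9 Fq.
set v := nth s vis h in q9 *.
apply: timed_emit; first reflexivity.
rewrite /goto /= q9 Fq // r6.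
have dv : d v = Some k.
  exact: is_dist_unique (d_dist v) (bfs_dist (table_uniq T) B lt_he).
case: HI => In Is Id Ih; have [l [ul lE ll]] := Ih v.
have degE : deg G v = size l.
  rewrite /deg -(card_uniqP ul); apply: eq_card => u.
  by rewrite inE lE.
have lt_l : size l < 2 ^ w.
  have : deg G v <= n by rewrite -[leqRHS]card_ord; apply: max_card.
  by rewrite degE; lia.
apply: (timed_mono (b := (21 * size l + 12.+1).+3) (Q := solved (rcons (take h vis) v))).
- by move=> out cf /solved_cons; rewrite /report dv.
- by have := max_deg_ge v; rewrite /D; lia.
apply: (timed_set (v' := h.+1));
  [reflexivity|by rewrite /= !Fq // r4 r1 addn1|lia|].
apply: (timed_set (v' := size l));
  [reflexivity|by rewrite /= ?updE /= q9 Id degE|done|].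
apply: (timed_set (v' := in_head I v %% 2 ^ w)).
- reflexivity.
- by rewrite /= ?updE /= q9 modn_mod.
- by rewrite ltn_pmod // expn_gt0.
apply: (timed_scan T (l := l) (h := h.+1) (e := e) (k := k)) => //=.
- by split; rewrite /= ?updE /= ?Fq.
- by rewrite /= ?updE /=; apply: linked_list_mod.
move=> r' lz' new mn T' F'.
have tk : take h.+1 (vis ++ new) = rcons (take h vis) v.
  by rewrite (take_nth s) ?size_cat ?ltn_addr // nth_cat lt_hv take_cat lt_hv.
rewrite -tk; apply: H => //; apply: bfs_scan => // u.
by rewrite mn !inE lE.
Qed.

Lemma timed_main r lz vis h e k :
  table lz vis -> frame r (size vis) h e k -> bfs G s vis h e k ->
  timed 12 (state main_pc r lz) (solved (take h vis)).
Proof.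
(* Every dequeue advances [h], which stays bounded by [h <= e <= size vis <= n]. *)
have [i] := ubnP (n - h); elim: i => // i IH in r lz vis h e k *.
move=> le_i T F B; case: (F) => r0 r1 r2 r3 r4 r5 r6.
have sz := table_size T; have [he ev ke _ _ _] := B.
apply: timed_next; first reflexivity.
rewrite /goto /= r4 r5.
move: he; rewrite leq_eqVlt => /predU1P[heE|lt_he]; last first.
  rewrite lt_he; apply: timed_mono (timed_dequeue T F B lt_he _) => //.
  by move=> ? ? ? _ T' F' B'; apply: IH T' F' B'; lia.
rewrite heE ltnn.
apply: timed_next; first reflexivity.
rewrite /goto /= r5 r3.
move: ev; rewrite leq_eqVlt => /predU1P[eE|lt_ev].
  rewrite eE eqxx take_size; apply: (timed_mono (b := 6) (Q := solved vis)) => //.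
  apply: timed_rest T F _ => v vv; rewrite heE eE in B.
  exact: is_dist_unique (d_dist v) (bfs_unreachable B vv).
rewrite ltn_eqF //.
apply: (timed_set (v' := size vis)); [reflexivity|by rewrite /= ?r3|lia|].
(* The distance fits in a word because [k < e < size vis <= n]. *)
apply: (timed_set (v' := k.+1));
  [reflexivity|by rewrite /= ?updE /= r6 r1 addn1|lia|].
rewrite heE in B le_i; have B' := bfs_next_level B lt_ev.
apply: timed_mono (timed_dequeue T _ B' lt_ev _) => //.
  by split; rewrite /= ?updE //= r4.
by move=> ? ? ? _ T' F'' B''; apply: IH T' F'' B''; lia.
Qed.

(** The source is enqueued by jumping into the visit code with register 8 still zero, so the scan
    ends at once. The budget is 7 + 17 + 1 + 12. *)
Lemma timed_init :
  timed 37 (init m) (solved [::]).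
Proof.
case: HI => In Is _ _.
apply: (timed_set (v' := n)); [reflexivity|by rewrite In|lia|].
apply: (timed_set (v' := 1)); [reflexivity|done|lia|].
apply: (timed_set (v' := n + n)); [reflexivity|done|lia|].
apply: timed_next.
  rewrite /step /= ?updE /=.
  have -> : 0 + (n + n) <= 2 ^ w by lia.
  reflexivity.
(* The block has base 0, so positions serve directly as addresses. *)
rewrite /= mod0n.
apply: (timed_set (v' := 1)); [reflexivity|done|lia|].
apply: (timed_set (v' := s));
  [reflexivity|by rewrite Is|have := ltn_ord s; lia|].
apply: timed_next; first reflexivity.
apply: (timed_visit (v := s) (h := 0) (e := 1) (k := 0) (table_init n)) => //=.
move=> r lz vis /= -> T F r7 r8.
apply: timed_next; first reflexivity.
rewrite /goto /= r8 (frame0 F) /= ?updE /=.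
rewrite -(take0 [:: s]); apply: (timed_main T F (bfs_init G s)).
Qed.

End Correctness.

Theorem theorem1 :
  exists P : program,
  (* hidden constants: word size, delay, lazy-initialized memory, space *)
  exists cw cd cl cs : nat,
  forall (n : nat) (G : graph n) (s : 'I_n) (w : nat) (I : input)
         (mem0 : nat -> nat),
    cw * (trunc_log 2 n).+1 <= w ->
    represents w I G s ->
    exists (delays : seq nat) (out : seq (nat * option nat)) (cf : config),
      [/\ run w P I (init mem0) delays out cf,
          sssd_solution G s out,
          all (fun d => d <= cd * (max_deg G).+1) delays,
          (n <= cl * lazy_size cf) && (lazy_size cf <= cl * n) &
          (n <= cs * space P cf) && (space P cf <= cs * n)].
Proof.
(* Since [n > 0], word size factor 2 gives [2 ^ w >= (n + 1) ^ 2 > 2 * n + 1]. Further, 62 is 22 +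
   40 from [D] and also covers the initial 37; the lazy memory has [2 * n] cells; the space is 15 +
   6 * n + 1, at most [22 * n]. *)
exists sssd_program, 2, 62, 2, 22 => n G s w I m le_w HI.
have n_gt0 : 0 < n := leq_ltn_trans (leq0n s) (ltn_ord s).
have w_large : 2 * n + 1 < 2 ^ w.
  have lt_n : n < 2 ^ (trunc_log 2 n).+1 by apply: trunc_log_ltn.
  have : 2 ^ (2 * (trunc_log 2 n).+1) <= 2 ^ w by rewrite leq_exp2l.
  apply: leq_trans; rewrite [2 * _.+1]mulnC expnM -mulnn.
  by apply: (@leq_trans (n.+1 * n.+1)); [nia|apply: leq_mul].
have [d d_dist] := dist_exists G s.
have [x [ds [out [cf [H le_x le_ds [sol ms ls]]]]]] :=
  timed_init m w_large HI d_dist.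
exists (x :: ds), out, cf; split=> //.
- apply/andP; split; first lia.
  by apply: sub_all le_ds => y; lia.
- by rewrite ls; apply/andP; split; lia.
- by rewrite /space ms ls; have -> : num_regs sssd_program = 15 by []; apply/andP; split; lia.
Qed.
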